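(* Let $n\geqslant 7$ and let $C_n^2$ be the square of the cycle $C_n$ of length $n$. Then $C_n^2$ is fully orientable.
   Context: All graphs are simple. $C_n=v_0v_1\cdots v_{n-1}v_0$ denotes the cycle of length $n$. For a connected graph $G$, its square $G^2$ has vertex set $V(G)$, and two distinct vertices are adjacent in $G^2$ if and only if their distance in $G$ is at most $2$. An orientation of a graph $G$ assigns a direction to each edge; it is acyclic if it contains no directed cycle. In an acyclic orientation $D$ of $G$, an arc is called dependent if reversing it (keeping all other arcs) creates a directed cycle; $d(D)$ denotes the number of dependent arcs of $D$. Let $d_{\min}(G)$ and $d_{\max}(G)$ be the minimum and maximum of $d(D)$ over all acyclic orientations $D$ of $G$. The graph $G$ is fully orientable if for every integer $k$ with $d_{\min}(G)\leqslant k\leqslant d_{\max}(G)$ there is an acyclic orientation $D$ of $G$ with $d(D)=k$. *)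

(* Defs.v *)
From mathcomp Require Import all_boot.

Set Implicit Arguments.
Unset Strict Implicit.
Unset Printing Implicit Defensive.

Record sgraph := SGraph {
  vertex :> finType;
  adj : rel vertex;
  adj_sym : symmetric adj;
  adj_irr : irreflexive adj }.

(* Two vertices of the same component are at distance at most #|G|.-1; vertices
   of different components receive the value #|G|.+1. *)
Definition dist (G : sgraph) (x y : G) : nat :=
  find (fun k => [exists p : k.-tuple G, path (@adj G) x p && (last x p == y)])
    (iota 0 #|G|.+1).

Lemma dist_sym (G : sgraph) (x y : G) : dist x y = dist y x.
Proof.
rewrite /dist; apply: eq_find => k.
suff walk_rev u v :
    [exists p : k.-tuple G, path (@adj G) u p && (last u p == v)] ->
    [exists p : k.-tuple G, path (@adj G) v p && (last v p == u)].
  by apply/idP/idP; exact: walk_rev.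
case/existsP=> p /andP[up /eqP <-]; apply/existsP.
have szq : size (rev (belast u p)) == k by rewrite size_rev size_belast size_tuple.
exists (Tuple szq); rewrite /= rev_path (eq_path (e' := @adj G)) ?up.
  by case: (tval p) => //= a s; rewrite rev_cons last_rcons.
by move=> a b; rewrite adj_sym.
Qed.

Section Square.
Variable G : sgraph.

Definition square_adj : rel G := fun x y => (x != y) && (dist x y <= 2).

Fact square_adj_sym : symmetric square_adj.
Proof. by move=> x y; rewrite /square_adj eq_sym dist_sym. Qed.

Fact square_adj_irr : irreflexive square_adj.
Proof. by move=> x; rewrite /square_adj eqxx. Qed.

Definition square : sgraph := SGraph square_adj_sym square_adj_irr.

End Square.

Section Cycle.
Variable n : nat.

(* ordS i is i + 1 modulo n; the condition i != j only matters for n = 1. *)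
Definition cycle_adj : rel 'I_n :=
  fun i j => (i != j) && ((j == ordS i) || (i == ordS j)).

Fact cycle_adj_sym : symmetric cycle_adj.
Proof. by move=> i j; rewrite /cycle_adj eq_sym orbC. Qed.

Fact cycle_adj_irr : irreflexive cycle_adj.
Proof. by move=> i; rewrite /cycle_adj eqxx. Qed.

Definition cycle_graph : sgraph := SGraph cycle_adj_sym cycle_adj_irr.

End Cycle.

Section Digraph.
Variable T : finType.
Implicit Types (D : {set T * T}) (a : T * T).

Definition arc D : rel T := fun x y => (x, y) \in D.

(* A directed cycle has no repeated vertex, hence at most #|T| vertices. *)
Definition has_dicycle D : bool :=
  [exists k : 'I_#|T|.+1, exists c : k.-tuple T,
     (0 < k) && ucycleb (arc D) c].

Lemma has_dicycleP D :
  reflect (exists2 c : seq T, c != [::] & ucycle (arc D) c) (has_dicycle D).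
Proof.
apply: (iffP existsP) => [[k /existsP[c /andP[k_gt0 Dc]]] | [c c_n0 /andP[Dc Uc]]].
  by exists c => //; rewrite -size_eq0 size_tuple -lt0n.
have szc : size c < #|T|.+1 by rewrite ltnS -(card_uniqP Uc) max_card.
exists (Ordinal szc); apply/existsP; exists (in_tuple c).
by rewrite /= lt0n size_eq0 c_n0 /ucycleb Dc Uc.
Qed.

Definition reverse_arc D a : {set T * T} := (a.2, a.1) |: (D :\ a).

Definition dependent_arcs D : {set T * T} :=
  [set a in D | has_dicycle (reverse_arc D a)].

Definition num_dependent D : nat := #|dependent_arcs D|.

End Digraph.

Section Orientation.
Variable G : sgraph.
Implicit Types D : {set G * G}.

Definition is_orientation D : bool :=
  [forall x : G, forall y : G,
     ((((x, y) \in D) || ((y, x) \in D)) == adj x y)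
     && ~~ (((x, y) \in D) && ((y, x) \in D))].

Definition acyclic_orientation D : bool := is_orientation D && ~~ has_dicycle D.

Definition rank_orientation : {set G * G} :=
  [set a | adj a.1 a.2 && (enum_rank a.1 < enum_rank a.2)].

Lemma rank_orientation_acyclic : acyclic_orientation rank_orientation.
Proof.
apply/andP; split.
  apply/forallP=> x; apply/forallP=> y; rewrite !inE /= (adj_sym y x).
  have [xy|yx|/val_inj/enum_rank_inj->] := ltngtP (enum_rank x) (enum_rank y).
  - by case: (adj x y).
  - by case: (adj x y).
  - by rewrite adj_irr.
apply/has_dicycleP=> -[[|x s] // _ /andP[/= Dc _]].
pose r := [rel u v : G | enum_rank u < enum_rank v].
have r_tr : transitive r by move=> v u w; apply: ltn_trans.
have : path r x (rcons s x).
  by apply: sub_path Dc => u v; rewrite /arc inE => /andP[].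
move/(order_path_min r_tr)/allP/(_ x).
by rewrite mem_rcons inE eqxx /= ltnn => /(_ isT).
Qed.

(* rank_orientation only witnesses that the set of values is nonempty. *)
Definition dmin : nat :=
  num_dependent [arg min_(D < rank_orientation | acyclic_orientation D)
                   num_dependent D].

Definition dmax : nat :=
  num_dependent [arg max_(D > rank_orientation | acyclic_orientation D)
                   num_dependent D].

Definition fully_orientable : Prop :=
  forall k : nat, dmin <= k <= dmax ->
    exists2 D : {set G * G}, acyclic_orientation D & num_dependent D = k.

End Orientation.

(* Main.v *)
Require Import Defs.
From mathcomp Require Import all_boot.
From mathcomp Require Import zify.
(* MathComp's path library also exports an [arc]; this makes [Defs.arc] prevail. *)
Import Defs.

(** Every arc in the covering relation of an acyclic orientation is independent,
    and the covering relation connects the graph, so at most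
    2n - (n - 1) = n + 1 of the 2n arcs are dependent.

    Conversely, the n triangles v_i v_(i+1) v_(i+2) each contain a dependent
    arc, where an arc v_i v_(i+2) lies in one triangle and v_i v_(i+1) in two;
    hence 2d >= n.  If 2d <= n + 1, then at all but at most one triangle exactly
    one arc is dependent and it joins consecutive vertices; this forces the
    arcs v_i v_(i+2) to run all in the same direction round the cycle, except
    for the one of the exceptional triangle, which yields a directed cycle for n
    even and too many dependent arcs for n odd.  Hence 2d >= n + 2.

    The intermediate values are realised by orienting the edges along a
    numbering of the vertices: the natural order gives n + 1, a zigzag
    around the whole cycle gives the minimum, and a zigzag on the first 2p vertices
    continued by a path, with v_(n-1) inserted low, gives n + 1 - p. *)

Set Implicit Arguments.
Unset Strict Implicit.
Unset Printing Implicit Defensive.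

(** * Acyclic digraphs and their dependent arcs *)

Section Increasing.
Variables (T : finType) (D : {set T * T}).

Lemma increasing_acyclic (f : T -> nat) :
  (forall x y, arc D x y -> f x < f y) -> ~~ has_dicycle D.
Proof.
move=> f_incr; apply/has_dicycleP=> -[[|x s] // _ /andP[/= Dc _]].
have r_tr : transitive [rel u v | f u < f v] by move=> v u w; apply: ltn_trans.
have Dr : path [rel u v | f u < f v] x (rcons s x).
  by apply: sub_path Dc => u v; apply: f_incr.
have /allP/(_ x) := order_path_min r_tr Dr.
by rewrite mem_rcons inE eqxx /= ltnn => /(_ isT).
Qed.

Lemma increasing_connect (f : T -> nat) x y :
  (forall u v, arc D u v -> f u < f v) -> connect (arc D) x y ->
  (x == y) || (f x < f y).
Proof.
move=> f_incr /connectP[p Dp ->] {y}; elim: p x Dp => [|z p IHp] x /=.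
  by rewrite eqxx.
case/andP=> /f_incr fxz /IHp /orP[/eqP<-|fz]; first by rewrite fxz orbT.
by rewrite (ltn_trans fxz fz) orbT.
Qed.

End Increasing.

Section Acyclic.
Variables (T : finType) (D : {set T * T}).
Hypothesis Dacyclic : ~~ has_dicycle D.

Lemma acyclic_connect x y : arc D x y -> ~~ connect (arc D) y x.
Proof.
move=> Dxy; apply: contra Dacyclic => /connectP[p Dp def_x].
apply/has_dicycleP; case/shortenP: Dp def_x => p' Dp' Up' _ def_x.
by exists (y :: p') => //; rewrite /ucycle /= rcons_path Dp' -def_x Dxy.
Qed.

(** Counting ancestors supplies a function that increases strictly along every arc. *)
Definition height x := #|[pred u | connect (arc D) u x]|.

Lemma height_incr x y : arc D x y -> height x < height y.
Proof.
move=> Dxy; apply/proper_card/properP; split.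
  by apply/subsetP=> u; rewrite !inE => /connect_trans-> //; apply: connect1.
by exists y; rewrite inE ?connect0 ?acyclic_connect.
Qed.

Lemma acyclic_antisym x y :
  connect (arc D) x y -> connect (arc D) y x -> x = y.
Proof.
move=> /(increasing_connect height_incr) xy /(increasing_connect height_incr).
case/predU1P: xy => // xy /predU1P[//|/(ltn_trans xy)]; by rewrite ltnn.
Qed.

(** A directed cycle created by reversing [(x, y)] uses [(y, x)], so it amounts to a second path
    from [x] to [y]. Naming its first vertex [z] after [x] suffices: by acyclicity a path from [z]
    never returns to [x], hence never uses [(x, y)]. *)
Lemma dependentP x y : arc D x y ->
  reflect (exists z, [/\ arc D x z, z != y & connect (arc D) z y])
          ((x, y) \in dependent_arcs D).
Proof.
move=> Dxy; rewrite inE [_ \in D]Dxy /=; apply: (iffP idP).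
- pose e := arc (D :\ (x, y)); have [xy _|xNy] := boolP (connect e x y).
    have /connectP[[|z p] /=] := xy.
      by move=> _ eq_yx; have := height_incr Dxy; rewrite eq_yx ltnn.
    case/andP=> exz ep def_y; exists z; move: exz; rewrite /e /arc !inE.
    rewrite xpair_eqE eqxx /= => /andP[zy Dxz]; split=> //.
    apply/connectP; exists p => //; apply: sub_path ep => u v.
    by rewrite /e /arc inE => /andP[].
(* Raising what x still reaches without the arc (x, y) above y gives a height
   function for the digraph with that arc reversed. *)
  pose f u := height u + (if connect e x u then (height y).+1 else 0).
  have /negP nc : ~~ has_dicycle (reverse_arc D (x, y)); last by move/nc.
  apply: (increasing_acyclic (f := f)) => u v; rewrite /arc !inE /= xpair_eqE.
  case/orP=> [/andP[/eqP-> /eqP->]|/andP[uv Duv]]; rewrite /f.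
    by rewrite connect0 (negPf xNy); lia.
  have fuv := height_incr Duv; case: ifP => xu; last by case: ifP => _; lia.
  rewrite (connect_trans xu) ?ltn_add2r //.
  by apply: connect1; rewrite /e /arc !inE uv.
case=> z [Dxz zy /connectP[p Dp def_y]].
apply/has_dicycleP; case/shortenP: Dp def_y => {p} p Dp Up _ def_y.
have xNp : x \notin z :: p.
  by apply: contra (acyclic_connect Dxz) => xp; rewrite (path_connect Dp).
exists [:: x, z & p] => //; rewrite /ucycle cons_uniq xNp Up !andbT /=.
rewrite rcons_path -def_y {3}/arc !inE eqxx andbT; apply/andP; split.
  by rewrite /arc !inE [_ \in D]Dxz !xpair_eqE eqxx zy !orbT.
apply: (sub_in_path (P := predC1 x)) Dp => [u v ux _ Duv|].
  by rewrite /arc !inE [_ \in D]Duv !xpair_eqE (negPf ux) /= orbT.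
by apply/allP=> u up; apply: contraNneq xNp => <-.
Qed.

Lemma dependent_connect x y z : arc D x y -> x != z -> z != y ->
  connect (arc D) x z -> connect (arc D) z y -> (x, y) \in dependent_arcs D.
Proof.
move=> Dxy xz zy cxz czy; apply/(dependentP Dxy).
case/connectP: cxz xz => -[|u p] /= => [_ -> /eqP //|/andP[Dxu Dp] def_z xz].
have cuz : connect (arc D) u z by apply/connectP; exists p.
exists u; split=> //; last exact: connect_trans czy.
apply: contra zy => /eqP def_u; apply/eqP/acyclic_antisym => //.
by rewrite -def_u.
Qed.

(** A second path would leave [x] through some [z] other than [y] and then climb strictly from [f z]
    to [f y]. *)
Lemma not_dependent_out (f : T -> nat) x y : arc D x y ->
  (forall u v, arc D u v -> f u < f v) ->
  (forall z, arc D x z -> z != y -> f y <= f z) ->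
  (x, y) \notin dependent_arcs D.
Proof.
move=> Dxy f_incr f_out; apply/negP=> /(dependentP Dxy)[z [Dxz zy]].
move=> /(increasing_connect f_incr); rewrite (negPf zy) /= ltnNge.
by rewrite f_out.
Qed.

Lemma not_dependent_in (f : T -> nat) x y : arc D x y ->
  (forall u v, arc D u v -> f u < f v) ->
  (forall z, arc D z y -> z != x -> f z <= f x) ->
  (x, y) \notin dependent_arcs D.
Proof.
move=> Dxy f_incr f_in; apply/negP=> /(dependentP Dxy)[z [Dxz zy]].
case/connectP=> p; case/lastP: p => [_ /eqP|p w]; first by rewrite eq_sym (negPf zy).
rewrite rcons_path last_rcons => /andP[Dp Dw] def_y; rewrite -{}def_y in Dw.
have cz : connect (arc D) z (last z p) by apply/connectP; exists p.
have fxw : f x < f (last z p).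
  have /predU1P[<-|] := increasing_connect f_incr cz; first exact: f_incr.
  exact: ltn_trans (f_incr _ _ Dxz).
have [eqx|nx] := eqVneq (last z p) x; first by rewrite eqx ltnn in fxw.
by have := f_in _ Dw nx; rewrite leqNgt fxw.
Qed.

End Acyclic.

(** * Adjacency, cuts and arc counts in the square of a cycle *)

Lemma dist_le2 (G : sgraph) (x y : G) : 1 < #|G| ->
  (dist x y <= 2) = [|| x == y, adj x y | [exists z, adj x z && adj z y]].
Proof.
(* With at least two vertices, the lengths tried include 2 and the value for a failed search exceeds
   2. *)
rewrite /dist; case: #|G| => [|[|k]] //= _.
have -> : [exists p : 0.-tuple G, path (@adj G) x p && (last x p == y)] = (x == y).
  by apply/existsP/idP=> [[p]|xy]; [rewrite tuple0 | exists [tuple]].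
have -> : [exists p : 1.-tuple G, path (@adj G) x p && (last x p == y)] = adj x y.
  apply/existsP/idP=> [[[[|z[|//]] //= _]]|xy]; last by exists [tuple y]; rewrite /= xy eqxx.
  by rewrite andbT => /andP[xz /eqP<-].
have -> : [exists p : 2.-tuple G, path (@adj G) x p && (last x p == y)] =
          [exists z, adj x z && adj z y].
  apply/existsP/existsP=> [[[[|z[|w[|//]]] //= _]]|[z /andP[xz zy]]].
    by rewrite andbT => /andP[/andP[xz zw] /eqP<-]; exists z; rewrite xz zw.
  by exists [tuple z; y]; rewrite /= xz zy eqxx.
by case: ifP => // _; case: ifP => // _; case: ifP.
Qed.

Definition joined (T : finType) (A : {set T * T}) (x y : T) :=
  ((x, y) \in A) || ((y, x) \in A).

Lemma joinedC (T : finType) (A : {set T * T}) : symmetric (joined A).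
Proof. by move=> x y; apply: orbC. Qed.

Section CycleSquare.
Variable n : nat.
Hypothesis n_ge7 : 7 <= n.
Notation G := (square (cycle_graph n)).
Implicit Types (x y z : 'I_n) (D : {set G * G}).

Lemma val_ordS x : ordS x = (if x.+1 < n then x.+1 else 0) :> nat.
Proof.
rewrite /=; case: ltnP => [/modn_small //|nx].
by have -> : x.+1 = n by [have := ltn_ord x; lia]; rewrite modnn.
Qed.

Lemma val_iter_ordS k x : iter k (@ordS n) x = (x + k) %% n :> nat.
Proof.
elim: k => [|k IHk] /=; first by rewrite addn0 modn_small.
by rewrite IHk addnS -addn1 modnDml addn1.
Qed.

Lemma ord_eqE x y : (x == y) = (x == y :> nat).
Proof. by []. Qed.

Lemma square_cycle_ordS x y : @adj G x y =
  [|| y == ordS x, y == ordS (ordS x), x == ordS y | x == ordS (ordS y)].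
Proof.
rewrite /= /square_adj dist_le2; last by rewrite card_ord; lia.
have cadj u v : @adj (cycle_graph n) u v = (u != v) && ((v == ordS u) || (u == ordS v)) by [].
rewrite cadj; apply/andP/idP.
  case=> xy /or3P[/eqP exy|/andP[_ /orP[]->]|/existsP[z]]; rewrite ?orbT //.
    by rewrite exy eqxx in xy.
  rewrite !cadj => /andP[/andP[_ /orP[]/eqP xz] /andP[_ /orP[]/eqP zy]].
  - by rewrite zy xz eqxx !orbT.
  - by move/ordS_inj: (etrans (esym xz) zy) xy => ->; rewrite eqxx.
  - by rewrite xz zy eqxx in xy.
  - by rewrite xz zy eqxx !orbT.
have nS (u : 'I_n) : u != ordS u.
  by rewrite ord_eqE val_ordS; have := ltn_ord u; case: ifP; lia.
have nSS (u : 'I_n) : u != ordS (ordS u).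
  by rewrite ord_eqE !val_ordS; have := ltn_ord u; do 2![case: ifP]; lia.
case/or4P=> /eqP->.
- by rewrite nS eqxx !orbT.
- rewrite nSS; split=> //; apply/or3P/Or33/existsP; exists (ordS x).
  by rewrite !cadj !nS !eqxx.
- by rewrite eq_sym nS eqxx !orbT.
- rewrite eq_sym nSS; split=> //; apply/or3P/Or33/existsP; exists (ordS y).
  by rewrite adj_sym [X in _ && X]adj_sym !cadj !nS !eqxx.
Qed.

Lemma square_cycle_adj x y : @adj G x y =
  ((x < y) && ((y <= x.+2) || (x + n <= y.+2))) ||
  ((y < x) && ((x <= y.+2) || (y + n <= x.+2))).
Proof.
rewrite square_cycle_ordS !ord_eqE !val_ordS.
by move: (ltn_ord x) (ltn_ord y) => /= xn yn; repeat case: ifP; lia.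
Qed.

(** A nonempty set closed under [ordS] contains every vertex, so some [x] in [A] has its successor
    outside. *)
Lemma square_cycle_cut (A : {set 'I_n}) : A != set0 -> A != setT ->
  exists x y, [/\ x \in A, y \notin A & @adj G x y].
Proof.
case/set0Pn=> a Aa; rewrite -subTset => /subsetPn[b _ Ab].
have [closedA|] := boolP [forall x in A, ordS x \in A]; last first.
  case/forall_inPn=> x Ax ASx; exists x, (ordS x); split=> //.
  by rewrite square_cycle_ordS eqxx.
case/negP: Ab; have Aiter k : iter k (@ordS n) a \in A.
  by elim: k => //= k; apply: (forall_inP closedA).
suff -> : b = iter (b + (n - a)) (@ordS n) a by [].
apply/val_inj; rewrite /= val_iter_ordS addnCA subnKC 1?ltnW //.
by rewrite modnDr modn_small.
Qed.

Lemma sum_ordS (F : 'I_n -> nat) : \sum_x F (ordS x) = \sum_x F x.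
Proof. by rewrite [RHS](reindex_inj (@ordS_inj n)). Qed.

Lemma card_arcs D (A : {set G * G}) : is_orientation D -> A \subset D ->
  #|A| = \sum_x (joined A x (ordS x) + joined A x (ordS (ordS x))).
Proof.
move=> /forallP Dor /subsetP AD.
have joinedE x y : joined A x y = ((x, y) \in A) + ((y, x) \in A) :> nat.
  have /forallP/(_ y)/andP[_] := Dor x; rewrite /joined.
  case: (boolP ((x, y) \in A)) => [/AD->|_] /=; last by case: (_ \in A).
  by case: (boolP ((y, x) \in A)) => [/AD->|].
(* [W x y] counts the ways to join [x] and [y] by one or two steps. It is 1 on every arc, as [n] is
   too large for coincidences; inserted as a factor, it splits the double sum into four single
   ones. *)
pose W x y := (y == ordS x) + (y == ordS (ordS x)) +
  ((x == ordS y) + (x == ordS (ordS y))).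
have W1 x y : (x, y) \in A -> W x y = 1.
  move=> /AD Dxy; have /forallP/(_ y)/andP[/eqP + _] := Dor x.
  rewrite /W Dxy /= => /esym; rewrite [LHS]square_cycle_ordS !ord_eqE !val_ordS.
  by move: (ltn_ord x) (ltn_ord y) => /= xn yn; repeat case: ifP; lia.
rewrite -sum1_card big_mkcond /=.
rewrite (eq_bigr (fun p => ((p.1, p.2) \in A) * W p.1 p.2)) => [|[x y] _ /=]; last first.
  by case: ifP => // /W1->.
rewrite -(pair_bigA _ (fun x y => ((x, y) \in A) * W x y)) /= /W.
have pick (f : 'I_n -> 'I_n) (B : rel 'I_n) :
    \sum_x \sum_y B x y * (y == f x) = \sum_x B x (f x).
  apply: eq_bigr => x _; rewrite (bigD1 (f x)) //= eqxx muln1.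
  by rewrite big1 ?addn0 // => y /negPf->; rewrite muln0.
under eq_bigr do (under eq_bigr do rewrite !mulnDr; rewrite !big_split /=).
rewrite !big_split /=.
rewrite (pick _ (fun x y => (x, y) \in A)) (pick _ (fun x y => (x, y) \in A)).
rewrite (exchange_big_dep predT) //= [X in _ + (_ + X)](exchange_big_dep predT) //=.
rewrite (pick _ (fun x y => (y, x) \in A)) (pick _ (fun x y => (y, x) \in A)).
by rewrite -!big_split; apply: eq_bigr => x _ /=; rewrite !joinedE addnACA.
Qed.

End CycleSquare.

(** * Bounds on the number of dependent arcs *)

Lemma card_cover_arcs (G : sgraph) (D : {set G * G}) :
  (forall A : {set G}, A != set0 -> A != setT ->
     exists x y, [/\ x \in A, y \notin A & adj x y]) ->
  acyclic_orientation D -> #|G| <= #|D :\: dependent_arcs D|.+1.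
Proof.
move=> Gconn /andP[/forallP Dor Dac]; set C := D :\: _.
(* A dependent arc crossing a cut is bypassed by a path, one of whose arcs crosses the same cut with
   a smaller difference of heights. Descending on this difference, bounded by [N], ends at an
   independent arc. *)
have cross (A : {set G}) N x y : height D y - height D x < N -> arc D x y ->
    (x \in A) != (y \in A) -> exists u v, (u, v) \in C /\ (u \in A) != (v \in A).
  elim: N x y => // N IHN x y; rewrite ltnS => hxy Dxy Axy.
  have [dep|ndep] := boolP ((x, y) \in dependent_arcs D); last first.
    by exists x, y; rewrite inE ndep.
  have [z [Dxz zy /connectP[p Dp def_y]]] := dependentP Dac Dxy dep.
  have hincr := height_incr Dac.
  have hxz := hincr _ _ Dxz.
  have hzy : height D z < height D y.
    have := increasing_connect hincr (path_connect Dp (mem_last z p)).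
    by rewrite -def_y (negPf zy).
  have [xz|xz] := eqVneq (x \in A) (z \in A); last first.
    by apply: (IHN x z _ Dxz xz); lia.
  rewrite xz in Axy; elim: p z Dp def_y hxz Axy {Dxz zy hzy xz} => [|w p IHp] u /=.
    by move=> _ ->; rewrite eqxx.
  case/andP=> Duw Dp def_y hu Auy; have huw := hincr _ _ Duw.
  have hwy : height D w <= height D y.
    have := increasing_connect hincr (path_connect Dp (mem_last w p)).
    by rewrite -def_y => /predU1P[->|/ltnW].
  have [uw|uw] := eqVneq (u \in A) (w \in A); last first.
    by apply: (IHN u w _ Duw uw); lia.
  by apply: (IHp w); rewrite -?uw // (ltn_trans hu).
(* As for a spanning tree, adding one end of a crossing independent arc at a time yields [k]
   vertices with at least [k - 1] independent arcs among them. *)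
suff grow k : 0 < k <= #|G| -> exists A : {set G},
    #|A| = k /\ k <= #|C :&: setX A A|.+1.
  have [->//|G_gt0] := posnP #|G|.
  have [|A [_ /leq_trans-> //]] := grow #|G|; first by rewrite G_gt0 leqnn.
  by rewrite ltnS subset_leq_card // subsetIl.
case/andP; elim: k => // k IHk _ kG; have [->|k_gt0] := posnP k.
  have /card_gt0P[a _] : 0 < #|G| by apply: leq_trans kG.
  by exists [set a]; rewrite cards1.
have [A [cardA geA]] := IHk k_gt0 (ltnW kG).
have [|| x [y [Ax Ay xy]]] := Gconn A.
- by rewrite -card_gt0 cardA.
- by apply: contraTneq kG => AT; rewrite -cardA AT cardsT ltnn.
have [u [v [Cuv Auv]]] : exists u v, (u, v) \in C /\ (u \in A) != (v \in A).
  have /forallP/(_ y)/andP[/eqP + _] := Dor x; rewrite xy => /orP[] Dxy.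
    by apply: (cross A _ x y (ltnSn _) Dxy); rewrite Ax (negPf Ay).
  by apply: (cross A _ y x (ltnSn _) Dxy); rewrite Ax (negPf Ay).
pose w := if u \in A then v else u.
have Aw : w \notin A by rewrite /w; case: ifP Auv => uA; rewrite ?uA //; case: (v \in A).
exists (w |: A); rewrite cardsU1 Aw cardA; split=> //.
rewrite ltnS (leq_trans geA) // proper_card //; apply/properP; split.
  by apply/setIS/setXS; apply: subsetUr.
exists (u, v); rewrite in_setI Cuv !inE /= /w.
  by case: (u \in A) Auv; case: (v \in A) => // _; rewrite eqxx ?orbT.
by case: (u \in A) Auv; case: (v \in A).
Qed.

(* [V] goes round the cycle; all its steps of length 2 except [V n.-1 -> V n.+1]
   follow [R], so for odd [n] they chain up to 1 -> 3 -> ... -> n = 0 -> 2 -> ... -> n - 1. *)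
Lemma twisted_chains (T : finType) (R dp : rel T) (n : nat) (V : nat -> T) :
    7 <= n -> V n = V 0 ->
    (forall i j, i < n -> j < n -> V i = V j -> i = j) ->
    (forall x y, connect R x y -> connect R y x -> x = y) ->
    (forall i, i.+1 < n -> R (V i) (V i.+2)) ->
    (forall i j z, (i, j) \in [:: (0, n.-1); (1, 0); (1, n.-1)] -> V i != z -> z != V j ->
       connect R (V i) z -> connect R z (V j) -> dp (V i) (V j)) ->
  [/\ dp (V 0) (V n.-1), dp (V 1) (V 0) & dp (V 1) (V n.-1)].
Proof.
move=> n7 Vn Vinj anti step dpP.
have Vneq i j : i < n -> j < n -> i != j -> V i != V j.
  by move=> ni nj; apply: contraNneq => /(Vinj _ _ ni nj)->.
have chain i j : i + j.*2 <= n -> connect R (V i) (V (i + j.*2)).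
  elim: j => [|j IHj] le_n; first by rewrite addn0 connect0.
  apply: connect_trans (IHj _) _; first lia.
  by rewrite doubleS !addnS; apply/connect1/step; lia.
have chainE i j k : i + j.*2 = k -> k <= n -> connect R (V i) (V k).
  by move=> <-; apply: chain.
have c02 : connect R (V 0) (V 2) by apply: (chainE 0 1); lia.
have c13 : connect R (V 1) (V 3) by apply: (chainE 1 1); lia.
(* For even [n] the chain from [V 2] ends at [V n = V 0], while [V 0] leads to [V 2], against
   antisymmetry. *)
have [n_odd|n_even] := boolP (odd n); last first.
  have c2n : connect R (V 2) (V 0).
    by rewrite -Vn; apply: (chainE 2 (n./2 - 1)); lia.
  have := Vneq 0 2; rewrite (anti _ _ c02 c2n) eqxx => /(_ _ _ isT).
  by case/(_ _ _)/notF; lia.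
have c2n : connect R (V 2) (V n.-1) by apply: (chainE 2 (n./2 - 1)); lia.
have c3n : connect R (V 3) (V 0).
  by rewrite -Vn; apply: (chainE 3 (n./2 - 1)); lia.
split.
- by apply: (dpP _ _ (V 2)); rewrite ?inE ?eqxx ?Vneq //; lia.
- by apply: (dpP _ _ (V 3)); rewrite ?inE ?eqxx ?orbT ?Vneq //; lia.
- apply: (dpP _ _ (V 0)); rewrite ?inE ?eqxx ?orbT ?Vneq //; try lia.
    exact: connect_trans c3n.
  exact: connect_trans c2n.
Qed.

Section AcyclicOrientation.
Variables (G : sgraph) (D : {set G * G}).
Hypothesis acycD : acyclic_orientation D.
Notation dep := (joined (dependent_arcs D)).

Lemma orientationN (x y : G) : adj x y -> ((y, x) \in D) = ((x, y) \notin D).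
Proof.
case/andP: acycD => /forallP/(_ x)/forallP/(_ y)/andP[/eqP<- + _].
by case: (_ \in D); case: (_ \in D).
Qed.

Lemma dep_between (x y z : G) : adj x y -> x != z -> z != y ->
  connect (arc D) x z -> connect (arc D) z y -> dep x y.
Proof.
move=> xy xz zy cxz czy; have [_ acD] := andP acycD.
have Dxy : arc D x y.
  apply: contraLR (connect_trans cxz czy); rewrite -orientationN // => Dyx.
  exact: acyclic_connect.
by rewrite /joined (dependent_connect acD Dxy xz zy).
Qed.

(** An edge spanned by a directed path along the other two is dependent. The edge [ac] weighs double
    because a step of length 2 lies in only one of the triangles to be summed over. At weight 1, [b]
    is a source or a sink of the triangle and exactly one of its two edges is dependent; this choice
    prescribes the direction of [ac]. *)
Lemma triangle_dep (a b c : G) : adj a b -> adj b c -> adj a c ->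
  0 < dep a b + dep b c + (dep a c).*2 /\
  (dep a b + dep b c + (dep a c).*2 = 1 ->
   [/\ ((b, c) \in D) = ((a, b) \notin D), dep b c = ~~ dep a b &
       ((a, c) \in D) = (dep a b == ((a, b) \in D))]).
Proof.
move=> ab bc ac.
have dep_path x y z : adj x y -> adj x z -> adj z y ->
    (x, z) \in D -> (z, y) \in D -> dep x y.
  move=> xy xz zy rxz rzy; apply: (dep_between xy (z := z)); try exact: connect1.
    by apply: contraTneq xz => ->; rewrite adj_irr.
  by apply: contraTneq zy => ->; rewrite adj_irr.
have ba : adj b a by rewrite adj_sym.
have cb : adj c b by rewrite adj_sym.
have ca : adj c a by rewrite adj_sym.
move: (dep_path _ _ _ ac ab bc) (dep_path _ _ _ ca cb ba).
move: (dep_path _ _ _ ab ac cb) (dep_path _ _ _ ba bc ca).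
move: (dep_path _ _ _ bc ba ac) (dep_path _ _ _ cb ca ab).
rewrite !(joinedC _ c) (joinedC _ b a).
rewrite (orientationN ab) (orientationN bc) (orientationN ac).
move: ((a, b) \in D) ((b, c) \in D) ((a, c) \in D) => r1 r2 r3.
move: (dep a b) (dep b c) (dep a c) => d1 d2 d3.
by case: r1; case: r2; case: r3; case: d1; case: d2; case: d3 => h1 h2 h3 h4 h5 h6;
  first [by split | by have := h1 isT isT | by have := h2 isT isT | by have := h3 isT isT |
         by have := h4 isT isT | by have := h5 isT isT | by have := h6 isT isT].
Qed.

End AcyclicOrientation.

Section Bounds.
Variable n : nat.
Hypothesis n_ge7 : 7 <= n.
Notation G := (square (cycle_graph n)).
Variable D : {set G * G}.
Hypothesis acycD : acyclic_orientation D.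

Lemma num_dependent_le : num_dependent D <= n.+1.
Proof.
have [Dor _] := andP acycD.
have depD : dependent_arcs D \subset D by apply/subsetP=> a; rewrite inE => /andP[].
have cardD : #|D| = n.*2.
  rewrite (card_arcs n_ge7 Dor (subxx _)) (eq_bigr (fun=> 2)).
    by rewrite sum_nat_const card_ord muln2.
  move=> x _; have joinedD y : @adj G x y -> joined D x y.
    by have /forallP/(_ x)/forallP/(_ y)/andP[/eqP + _] := Dor; rewrite /joined => ->.
  by rewrite !joinedD // square_cycle_ordS // eqxx ?orbT.
have := @card_cover_arcs G D (@square_cycle_cut n n_ge7) acycD.
by rewrite cardsDS // cardD [X in X <= _]card_ord /num_dependent; lia.
Qed.

Lemma num_dependent_ge : n.+2 <= (num_dependent D).*2.
Proof.
have [Dor Dac] := andP acycD.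
have depD : dependent_arcs D \subset D by apply/subsetP=> a; rewrite inE => /andP[].
pose dep : rel 'I_n := joined (dependent_arcs D).
pose P x := dep x (ordS x); pose T x := dep x (ordS (ordS x)).
(* A step of length 1 lies in two triangles and one of length 2 in a single triangle, so these
   weights add up to twice the number of dependent arcs. *)
pose E x := P x + P (ordS x) + (T x).*2.
have adjS x : @adj G x (ordS x) by rewrite square_cycle_ordS // eqxx.
have adjSS x : @adj G x (ordS (ordS x)) by rewrite square_cycle_ordS // eqxx orbT.
have E_gt0 x : 0 < E x.
  by have [] := triangle_dep acycD (adjS x) (adjS _) (adjSS x).
have sumE : \sum_x E x = (num_dependent D).*2.
  rewrite /E 2!big_split /= (sum_ordS P) addnn /num_dependent.
  rewrite (card_arcs n_ge7 Dor depD) big_split doubleD /=; congr (_ + _).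
  by rewrite -!muln2 big_distrl /=; apply: eq_bigr => x _; rewrite muln2.
rewrite -sumE leqNgt; apply/negP => sumE_lt.
(* Every weight is at least 1 and the total is below [n + 2], which leaves one unit of surplus.
   Distinct [x0], [x1] show that two triangles cannot both exceed 1; equal ones, that none exceeds
   2. *)
have small x0 x1 : exists x, E x < 1 + (x == x0) + (x == x1).
  apply/existsP; apply: contraLR sumE_lt; rewrite negb_exists -leqNgt => /forallP leE.
  have -> : n.+2 = \sum_x (1 + (x == x0) + (x == x1)).
    have sum_eq (a : 'I_n) : \sum_x (x == a) = 1.
      by rewrite (bigD1 a) //= eqxx big1 // => x /negPf->.
    by rewrite !big_split /= sum1_card card_ord !sum_eq !addn1.
  by apply: leq_sum => x _; rewrite leqNgt.
have [z Ez1 Ez2] : exists2 z, forall x, x != z -> E x = 1 & E z <= 2.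
  have [/existsP[z Ez]|] := boolP [exists x, 1 < E x]; last first.
    rewrite negb_exists => /forallP E_le1; have n_gt0 : 0 < n by lia.
    have E1 x : E x = 1 by apply/eqP; rewrite eqn_leq E_gt0 leqNgt E_le1.
    by exists (Ordinal n_gt0) => [x _|]; rewrite E1.
  exists z => [x xz|].
    have [w] := small z x; have [->|wz] := eqVneq w z.
      by rewrite eq_sym (negPf xz) addn0 ltnNge Ez.
    have [->|wx] := eqVneq w x; last by rewrite ltnNge E_gt0.
    by move=> Ex; apply/eqP; rewrite eqn_leq E_gt0 -ltnS Ex.
  by have [w] := small z z; case: eqP => [-> //|_]; rewrite ltnNge E_gt0.
(* Counting from the successor of [z] puts the exceptional triangle last, on [V n.-1], [V 0],
   [V 1]. *)
pose V i := iter i (@ordS n) (ordS z).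
have VS i : V i.+1 = ordS (V i) by [].
have VE i : V i = (z + i.+1) %% n :> nat by rewrite /V -iterSr val_iter_ordS.
have Vn : V n = V 0.
  by apply/val_inj; rewrite /= !VE addnS -addSn modnDr.
have Vn1 : V n.-1 = z.
  by apply/val_inj; rewrite /= VE prednK ?modnDr ?modn_small //; lia.
have Vinj i j : i < n -> j < n -> V i = V j -> i = j.
  move=> ni nj /(f_equal (@nat_of_ord n)); rewrite !VE.
  by move/eqP; rewrite eqn_modDl -[i.+1]addn1 -[j.+1]addn1 eqn_modDr !modn_small // => /eqP.
have EV i : i.+1 < n -> E (V i) = 1.
  move=> ni; apply: Ez1; rewrite -Vn1; apply/eqP=> eqV.
  have := Vinj i n.-1 (ltnW ni); rewrite prednK; last by lia.
  by move/(_ (leqnn _) eqV) => ei; rewrite ei prednK ?ltnn // in ni; lia.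
pose r x y := (x, y) \in D.
(* Across an ordinary triangle, both the dependence and the direction of the steps of length 1 flip.
   Whether they agree is thus an invariant [beta], which is also the direction of the steps of
   length 2. *)
have := erefl (P (V 0) == r (V 0) (V 1)); move: {-2}(_ == _) => beta beta0.
have betaE i : i.+1 < n -> (P (V i) == r (V i) (V i.+1)) = beta.
  elim: i => // i IHi ni; rewrite -(IHi (ltnW ni)).
  have [_ /(_ (EV i (ltnW ni)))[r2 d2 _]] :=
    triangle_dep acycD (adjS (V i)) (adjS _) (adjSS _).
  rewrite /r !VS r2 [P (ordS _)]d2.
  by rewrite -[P (V i)]/(joined _ _ _); move: (joined _ _ _) (_ \in D) => [] [].
have chord i : i.+1 < n -> r (V i) (V i.+2) = beta.
  move=> ni; rewrite -(betaE i ni).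
  by have [_ /(_ (EV i ni))[_ _ ]] := triangle_dep acycD (adjS (V i)) (adjS _) (adjSS _).
(* Reversing the arcs when [beta] is false treats both senses of rotation at once. *)
pose R x y := if beta then arc D x y else arc D y x.
have connR x y : connect R x y = if beta then connect (arc D) x y else connect (arc D) y x.
  by rewrite /R; case: (beta) => //; apply: connect_rev.
have V0E : V 0 = ordS (V n.-1) by rewrite Vn1.
have [] := @twisted_chains 'I_n R dep n V n_ge7 Vn Vinj.
- by move=> x y; rewrite !connR; case: (beta) => ? ?; apply: (acyclic_antisym Dac).
- move=> i ni; rewrite /R; have := chord i ni; case: (beta) => //.
  by rewrite /r /arc => nr; rewrite (orientationN acycD) ?nr ?adjSS.
- move=> i j w ij Viw wVj; rewrite !connR => c1 c2.
  have adjV : @adj G (V j) (V i).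
    move: ij; rewrite !inE => /or3P[] /eqP[-> ->].
    - by rewrite V0E adjS.
    - by rewrite VS adjS.
    - by rewrite VS V0E adjSS.
  rewrite /dep; case: (beta) c1 c2 => c1 c2.
    by apply: (@dep_between G D acycD _ _ w); rewrite // adj_sym.
  by rewrite joinedC; apply: (@dep_between G D acycD _ _ w); rewrite // eq_sym.
(* All edges of the exceptional triangle being dependent, its weight is 4 instead of at most 2. *)
move=> d1 d2 d3; move: Ez2; rewrite -Vn1 /E /P /T -V0E -VS.
by rewrite /dep !(joinedC _ (V n.-1)) [joined _ _ (V 1)]joinedC -/dep d1 d2 d3.
Qed.
End Bounds.

(** * Orientations along a numbering of the vertices *)

Section Orient.
Variable n : nat.
Hypothesis n_ge7 : 7 <= n.
Notation G := (square (cycle_graph n)).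

(** Adjacency in the square of the cycle on plain numbers, within reach of [lia]. *)
Definition near (i j : nat) :=
  ((i < j) && ((j <= i.+2) || (i + n <= j.+2))) ||
  ((j < i) && ((i <= j.+2) || (j + n <= i.+2))).

Definition orient (f : nat -> nat) : {set G * G} :=
  [set a : 'I_n * 'I_n | near a.1 a.2 && (f a.1 < f a.2)].

Variable f : nat -> nat.
Hypothesis f_near : forall i j, i < n -> j < n -> near i j -> f i != f j.
Notation D := (orient f).
Notation dep := (joined (dependent_arcs D)).
Implicit Types x y z : 'I_n.

Lemma orientE x y : arc D x y = near x y && (f x < f y).
Proof. by rewrite /arc inE. Qed.

Lemma orient_acyclic : acyclic_orientation D.
Proof.
apply/andP; split; last first.
  by apply: (increasing_acyclic (f := fun x : 'I_n => f x)) => x y; rewrite orientE => /andP[].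
apply/forallP=> x; apply/forallP=> y; rewrite square_cycle_adj // -/(near x y).
rewrite -!/(arc D _ _) !orientE.
have -> : near y x = near x y by rewrite /near orbC.
case: (boolP (near x y)) => //= /f_near; rewrite !ltn_ord => /(_ isT isT).
by case: ltngtP.
Qed.

Lemma orient_joined x y : near x y -> f x < f y -> dep x y = ((x, y) \in dependent_arcs D).
Proof.
move=> xy fxy; rewrite /joined; case: (boolP ((y, x) \in _)) => [|_]; last by rewrite orbF.
rewrite inE -/(arc D y x) orientE => /andP[/andP[_ fyx] _].
by have := ltn_trans fxy fyx; rewrite ltnn.
Qed.

Lemma orient_dep x y z : near x y -> near x z -> near z y -> f x < f z -> f z < f y ->
  dep x y.
Proof.
move=> xy xz zy fxz fzy; apply: (dep_between orient_acyclic (z := z)).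
- by rewrite square_cycle_adj.
- by apply: contraTneq fxz => ->; rewrite ltnn.
- by apply: contraTneq fzy => ->; rewrite ltnn.
- by apply: connect1; rewrite orientE xz.
- by apply: connect1; rewrite orientE zy.
Qed.

Lemma orient_connect s k x y : 0 < s <= 2 -> y = x + k * s :> nat ->
    (forall i, x <= i -> i + s <= y -> f i < f (i + s)) ->
  connect (arc D) x y.
Proof.
move=> s12; elim: k y => [|k IHk] y def_y f_incr.
  by have -> : y = x; [apply/val_inj; rewrite /= def_y mul0n addn0 | apply: connect0].
have zn : x + k * s < n by have := ltn_ord y; rewrite def_y; lia.
have y_z : y = Ordinal zn + s :> nat by rewrite def_y mulSn /=; lia.
apply: (connect_trans (y := Ordinal zn)).
  by apply: IHk => // i xi iz; apply: f_incr => //; rewrite y_z (leq_trans iz) ?leq_addr.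
apply: connect1; rewrite orientE y_z f_incr ?leq_addr ?y_z // andbT.
by rewrite /near; lia.
Qed.

Lemma orient_dep_chain s k x y z : near x y -> near x z -> f x < f z ->
    0 < s <= 2 -> y = z + k.+1 * s :> nat ->
    (forall i, z <= i -> i + s <= y -> f i < f (i + s)) ->
  dep x y.
Proof.
move=> xy xz fxz s12 def_y f_incr.
apply: (dep_between orient_acyclic (z := z)).
- by rewrite square_cycle_adj.
- by apply: contraTneq fxz => ->; rewrite ltnn.
- by apply: contra_eqN def_y => /eqP->; lia.
- by apply: connect1; rewrite orientE xz.
- exact: orient_connect def_y f_incr.
Qed.

Lemma orient_ndep_out (g : nat -> nat) x y : near x y -> f x < f y ->
    (forall i j, i < n -> j < n -> near i j -> f i < f j -> g i < g j) ->
    (forall i, i < n -> near x i -> f x < f i -> i != y -> g y <= g i) ->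
  dep x y = false.
Proof.
move=> xy fxy g_incr g_out; apply/negbTE; rewrite orient_joined //.
have /andP[_ Dac] := orient_acyclic.
apply: (not_dependent_out Dac (f := fun x : 'I_n => g x)).
- by rewrite orientE xy.
- by move=> u v; rewrite orientE => /andP[]; apply: g_incr.
- by move=> z; rewrite orientE => /andP[xz fxz] zy; apply: g_out.
Qed.

(** The test function [g] may differ from [f]: any function increasing along the arcs can certify
    independence, and [f] does not serve for every arc. *)
Lemma orient_ndep_in (g : nat -> nat) x y : near x y -> f x < f y ->
    (forall i j, i < n -> j < n -> near i j -> f i < f j -> g i < g j) ->
    (forall i, i < n -> near i y -> f i < f y -> i != x -> g i <= g x) ->
  dep x y = false.
Proof.
move=> xy fxy g_incr g_in; apply/negbTE; rewrite orient_joined //.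
have /andP[_ Dac] := orient_acyclic.
apply: (not_dependent_in Dac (f := fun x : 'I_n => g x)).
- by rewrite orientE xy.
- by move=> u v; rewrite orientE => /andP[]; apply: g_incr.
- by move=> z; rewrite orientE => /andP[zy fzy] zx; apply: g_in.
Qed.

(* [s0], [t0] and [t1] stand for the three edges that cross from the end of
   0, ..., n - 1 back to its beginning. *)
Lemma num_dependent_orient (s t : nat -> bool) (s0 t0 t1 : bool) :
    (forall x y, y = x.+1 :> nat -> dep x y = s x) ->
    (forall x y, y = x.+2 :> nat -> dep x y = t x) ->
    (forall x y, x = 0 :> nat -> y = n.-1 :> nat -> dep x y = s0) ->
    (forall x y, x = 0 :> nat -> y = n.-2 :> nat -> dep x y = t0) ->
    (forall x y, x = 1 :> nat -> y = n.-1 :> nat -> dep x y = t1) ->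
  num_dependent D = \sum_(i < n.-1) s i + \sum_(i < n.-2) t i + (s0 + t0 + t1).
Proof.
move=> Ds Dt Ds0 Dt0 Dt1; have /andP[Dor _] := orient_acyclic.
have depD : dependent_arcs D \subset D by apply/subsetP=> a; rewrite inE => /andP[].
rewrite /num_dependent (card_arcs n_ge7 Dor depD).
(* Listed by starting vertex, the crossing edge of [t0] belongs to [n - 2], those of [s0] and [t1]
   to [n - 1]. *)
pose F i := (if i.+1 < n then s i else s0) + 
   (if i.+2 < n then t i else if i.+1 < n then t0 else t1) : nat.
rewrite (eq_bigr (fun x : 'I_n => F x)) => [|x _]; last first.
  have := ltn_ord x; rewrite /F => x_n.
  have Sx := val_ordS n_ge7 x; have SSx := val_ordS n_ge7 (ordS x).
  have [x2|x2] := ltnP x.+2 n.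
    have x1 := ltnW x2; rewrite x1 in Sx *; rewrite Sx x2 in SSx.
    by rewrite (Ds _ _ Sx) (Dt _ _ SSx).
  have [x1|x1] := ltnP x.+1 n.
    rewrite x1 in Sx; rewrite Sx (leq_gtF x2) in SSx.
    by rewrite (Ds _ _ Sx) joinedC (Dt0 _ _ SSx) //; lia.
  rewrite (leq_gtF x1) in Sx; rewrite Sx in SSx.
  have {}SSx : ordS (ordS x) = 1 :> nat by rewrite SSx; case: ifP; lia.
  by rewrite joinedC (Ds0 _ _ Sx) ?[dep x _]joinedC ?(Dt1 _ _ SSx) //; lia.
rewrite -(big_mkord xpredT F) -(big_mkord xpredT (fun i => nat_of_bool (s i))).
rewrite -(big_mkord xpredT (fun i => nat_of_bool (t i))).
have [m def_n] : exists m, n = m.+2 by exists n.-2; lia.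
rewrite [in LHS]def_n [in RHS]def_n /=.
rewrite big_nat_recr //= big_nat_recr //= [in RHS]big_nat_recr //=.
have -> : F m = s m + t0 by rewrite /F def_n ltnSn ltnn.
have -> : F m.+1 = s0 + t1 by rewrite /F def_n ltnn leq_gtF.
rewrite (eq_big_nat _ _ (F2 := fun i => s i + t i)).
  by rewrite big_split /=; lia.
by move=> i /andP[_ i_n]; rewrite /F def_n !ltnS i_n ltnW.
Qed.
End Orient.

(** * Orientations realising each value between the bounds *)

Lemma sum_interval m a b : \sum_(i < m) (a <= i < b) = minn m b - a.
Proof. by elim: m => [|m IHm]; rewrite ?big_ord0 ?big_ord_recr /= ?IHm; lia. Qed.

Lemma sum_odd m b : \sum_(i < m) (odd i && (i < b.*2)) = minn m./2 b.
Proof. by elim: m => [|m IHm]; rewrite ?big_ord0 ?big_ord_recr /= ?IHm; lia. Qed.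

Section Families.
Variable n : nat.
Hypothesis n_ge7 : 7 <= n.
Notation G := (square (cycle_graph n)).

Lemma path_orientation : exists2 D : {set G * G},
  acyclic_orientation D & num_dependent D = n.+1.
Proof.
pose f (i : nat) := i.
have f_near i j : i < n -> j < n -> near n i j -> f i != f j by rewrite /near /f; lia.
exists (orient n f); first exact: orient_acyclic.
have n0 k : k < 7 -> k < n by lia.
pose o k (k7 : k < 7) := Ordinal (n0 k k7).
rewrite (num_dependent_orient n_ge7 f_near (s := xpred0) (t := xpredT)
  (s0 := true) (t0 := true) (t1 := true)).
- by rewrite sum_nat_const sum_nat_const !card_ord; lia.
- move=> x y xy; apply: (orient_ndep_out n_ge7 f_near (g := f));
    rewrite /near /f; lia.
- move=> x y xy; have x1 : x.+1 < n by have := ltn_ord y; lia.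
  by apply: (orient_dep n_ge7 f_near (z := Ordinal x1)); rewrite /near /f /=; lia.
- move=> x y x0 y0.
  by apply: (orient_dep n_ge7 f_near (z := o 1 isT)); rewrite /near /f /=; lia.
- move=> x y x0 y0; have y_n := ltn_ord y.
  by apply: (orient_dep_chain n_ge7 f_near (z := o 1 isT) (s := 1) (k := y - 2));
    rewrite /near /f /=; lia.
- move=> x y x0 y0; have y_n := ltn_ord y.
  by apply: (orient_dep_chain n_ge7 f_near (z := o 2 isT) (s := 1) (k := y - 3));
    rewrite /near /f /=; lia.
Qed.

Lemma zigzag_orientation : exists2 D : {set G * G},
  acyclic_orientation D & num_dependent D = (n.+1)./2.+1.
Proof.
(* The only arc whose independence the levels [f] do not show joins 0 to the last odd
   vertex; the order [g] puts 0 just below that vertex. *)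
pose f (i : nat) := i./2 + ~~ odd i.
pose g (i : nat) := if odd i then i./2 else n./2 - 2 + i./2.
have f_near i j : i < n -> j < n -> near n i j -> f i != f j by rewrite /near /f; lia.
have g_incr i j : i < n -> j < n -> near n i j -> f i < f j -> g i < g j.
  by rewrite /near /f /g; have [|] := boolP (odd i); have [|] := boolP (odd j); lia.
have g_in (x y i : nat) : x = 0 -> odd y -> n.-2 <= y < n -> i < n ->
    near n i y -> f i < f y -> i != x -> g i <= g x.
  by move=> ->; rewrite /near /f /g /=; have [|] := boolP (odd i); lia.
exists (orient n f); first exact: orient_acyclic.
have n0 k : k < 7 -> k < n by lia.
pose o k (k7 : k < 7) := Ordinal (n0 k k7).
(* From an odd [x] to [x.+1] the level rises by 2, with [x.-1] in between. Among the crossing edges,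
   0 reaches the last even vertex along the even chain and 1 reaches [n.-1] through 0. *)
rewrite (num_dependent_orient n_ge7 f_near (s := odd) (t := xpred0)
  (s0 := odd n) (t0 := ~~ odd n) (t1 := true)).
- rewrite (eq_bigr (fun i : 'I_n.-1 => odd i && (i < n.*2) : nat)) => [|i _].
    by rewrite sum_odd big1 //; lia.
  by have := ltn_ord i; case: (odd i); lia.
- move=> x y xy; have y_n := ltn_ord y; have [x_odd|x_even] := boolP (odd x).
    have x1 : x.-1 < n by lia.
    by apply: (orient_dep n_ge7 f_near (z := Ordinal x1)); rewrite /near /f /=; lia.
  rewrite joinedC; apply: (orient_ndep_out n_ge7 f_near (g := f));
    rewrite /near /f; lia.
- move=> x y xy; have y_n := ltn_ord y.
  apply: (orient_ndep_in n_ge7 f_near (g := f)); rewrite /near /f; lia.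
- move=> x y x0 y0; have y_n := ltn_ord y; have [n_odd|n_even] := boolP (odd n).
    by apply: (orient_dep_chain n_ge7 f_near (z := o 2 isT) (s := 2) (k := n./2 - 2));
      rewrite /near /f /=; lia.
  by apply: (orient_ndep_in n_ge7 f_near (g := g) _ _ g_incr);
    [rewrite /near; lia | rewrite /f; lia | move=> i; apply: g_in => //; lia].
- move=> x y x0 y0; have y_n := ltn_ord y; have [n_odd|n_even] := boolP (odd n).
    by apply: (orient_ndep_in n_ge7 f_near (g := g) _ _ g_incr);
      [rewrite /near; lia | rewrite /f; lia | move=> i; apply: g_in => //; lia].
  by apply: (orient_dep_chain n_ge7 f_near (z := o 2 isT) (s := 2) (k := n./2 - 3));
    rewrite /near /f /=; lia.
- move=> x y x0 y0; have y_n := ltn_ord y.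
  by apply: (orient_dep n_ge7 f_near (z := o 0 isT)); rewrite /near /f /=; lia.
Qed.

Lemma near_cases i j : i < n -> j < n -> near n i j ->
  j = i.+1 \/ j = i.+2 \/ i = j.+1 \/ i = j.+2 \/
  i + n = j.+1 \/ i + n = j.+2 \/ j + n = i.+1 \/ j + n = i.+2.
Proof. by rewrite /near; lia. Qed.

(* Splitting disjunctions beforehand keeps the certificates found by lia small. *)
Ltac case_lia := repeat match goal with H : _ \/ _ |- _ => destruct H end; lia.

Lemma mixed_orientation (p : nat) : 0 < p -> p.*2.+2 <= n ->
  exists2 D : {set G * G}, acyclic_orientation D & num_dependent D = n.+1 - p.
Proof.
move=> p_gt0 p_n.
(* On 0, ..., n - 2 this is twice the level in the covering relation; the value 3
   places n - 1 between 0, of value 2, and n - 3. *)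
pose f (i : nat) := if i == n.-1 then 3 else
  if p.*2 <= i then i.+1.*2 - p.*2 else if odd i then i.-1 else i.+2.
have f_last : f n.-1 = 3 by rewrite /f eqxx.
have f_path i : p.*2 <= i < n.-1 -> f i + p.*2 = i.*2.+2.
  by move=> /andP[pi ni]; rewrite /f ifF ?pi; lia.
have f_odd i : i < p.*2 -> odd i -> (f i).+1 = i.
  by move=> ip io; rewrite /f ifF ?(ltn_geF ip) ?io; [case: (i) io | lia].
have f_even i : i < p.*2 -> ~~ odd i -> f i = i.+2.
  by move=> ip io; rewrite /f ifF ?(ltn_geF ip) ?(negPf io); lia.
have fP i : i < n -> (i = n.-1 /\ f i = 3) \/
    (p.*2 <= i < n.-1 /\ f i + p.*2 = i.*2.+2) \/
    (i < p.*2 /\ odd i /\ (f i).+1 = i) \/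
    (i < p.*2 /\ ~~ odd i /\ f i = i.+2).
  move=> i_n; case: (eqVneq i n.-1) => [->|ni]; [by left|right].
  have [pi|pi] := leqP p.*2 i; [left|right].
    by split; [lia | apply: f_path; lia].
  have [io|ie] := boolP (odd i); [left|right].
    by rewrite f_odd.
  by rewrite f_even.
clearbody f.
have f_near i j : i < n -> j < n -> near n i j -> f i != f j.
  move=> i_n j_n /(near_cases i_n j_n) ij; have fi := fP i i_n; have fj := fP j j_n.
  by case_lia.
exists (orient n f); first exact: orient_acyclic.
have n0 k : k < 7 -> k < n by lia.
pose o k (k7 : k < 7) := Ordinal (n0 k k7).
have ndep_out (x y : 'I_n) : near n x y -> f x < f y ->
    (forall i, i < n -> near n x i -> f x < f i -> i != y -> f y <= f i) ->
    joined (dependent_arcs (orient n f)) x y = false.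
  by move=> xy fxy; apply: (orient_ndep_out n_ge7 f_near).
have ndep_in (x y : 'I_n) : near n x y -> f x < f y ->
    (forall i, i < n -> near n i y -> f i < f y -> i != x -> f i <= f x) ->
    joined (dependent_arcs (orient n f)) x y = false.
  by move=> xy fxy; apply: (orient_ndep_in n_ge7 f_near).
(* The dependent edges are [p] zigzag steps, the edge between [n - 2] and [n - 1], the [n - 2 - 2p]
   steps of length 2 ending on the path part, and two crossing edges. *)
rewrite (num_dependent_orient n_ge7 f_near
  (s := fun i => odd i && (i < p.*2) || (n.-2 <= i < n.-1))
  (t := fun i => p.*2.-1 <= i < n - 3) (s0 := false) (t0 := true) (t1 := true)).
- rewrite sum_interval.
  rewrite (eq_bigr (fun i : 'I_(n.-1) => (odd i && (i < p.*2) : nat) + (n.-2 <= i < n.-1))).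
    by rewrite big_split /= sum_odd sum_interval; lia.
  by move=> i _; have := ltn_ord i; case: (odd i); lia.
- move=> x y xy; have y_n := ltn_ord y; have x_n := ltn_ord x.
  have [y_p|y_p] := eqVneq (y : nat) n.-1.
    have z_n : n - 3 < n by lia.
    have fz := fP (n - 3) z_n; have fx : f x + p.*2 = x.*2.+2 by apply: f_path; lia.
    rewrite -y_p in f_last; rewrite joinedC.
    have -> : odd x && (x < p.*2) || (n.-2 <= x < n.-1) = true by lia.
    apply: (orient_dep n_ge7 f_near (z := Ordinal z_n)); rewrite /near /=; case_lia.
  have -> : (n.-2 <= x < n.-1) = false by lia.
  rewrite orbF; have [x_p|x_p] := ltnP x p.*2; last first.
    have fx : f x + p.*2 = x.*2.+2 by apply: f_path; lia.
    have fy : f y + p.*2 = y.*2.+2 by apply: f_path; lia.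
    rewrite andbF; apply: ndep_out; [rewrite /near; lia | lia |].
    move=> i i_n /(near_cases x_n i_n) ni; have fi := fP i i_n; case_lia.
  rewrite andbT; have [x_odd|x_even] := boolP (odd x).
    have z_n : x.-1 < n by lia.
    have fx := f_odd x x_p x_odd; have fy := fP y y_n.
    have fz : f x.-1 = x.+1 by rewrite f_even; lia.
    apply: (orient_dep n_ge7 f_near (z := Ordinal z_n)); rewrite /near /=; case_lia.
  have fx := f_even x x_p x_even; have fy : (f y).+1 = y by apply: f_odd; lia.
  rewrite joinedC; apply: ndep_out; [rewrite /near; lia | lia |].
  move=> i i_n /(near_cases y_n i_n) ni; have fi := fP i i_n; case_lia.
- move=> x y xy; have y_n := ltn_ord y; have x_n := ltn_ord x.
  have [y_p|y_p] := eqVneq (y : nat) n.-1.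
    have fx := fP x x_n; rewrite -y_p in f_last.
    have -> : (p.*2.-1 <= x < n - 3) = false by lia.
    rewrite joinedC; apply: ndep_out; [rewrite /near; lia | case_lia |].
    move=> i i_n /(near_cases y_n i_n) ni; have fi := fP i i_n; case_lia.
  have -> : (p.*2.-1 <= x < n - 3) = (p.*2.-1 <= x) by lia.
  have [x_p|x_p] := leqP p.*2.-1 x.
    have z_n : x.+1 < n by lia.
    have fx := fP x x_n; have fy : f y + p.*2 = y.*2.+2 by apply: f_path; lia.
    have fz : f x.+1 + p.*2 = x.+1.*2.+2 by apply: f_path; lia.
    apply: (orient_dep n_ge7 f_near (z := Ordinal z_n)); rewrite /near /=; case_lia.
  have [x_odd|x_even] := boolP (odd x).
    have fx : (f x).+1 = x by apply: f_odd; lia.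
    have fy : (f y).+1 = y by apply: f_odd; lia.
    apply: ndep_out; [rewrite /near; lia | lia |].
    move=> i i_n /(near_cases x_n i_n) ni; have fi := fP i i_n; case_lia.
  have fx : f x = x.+2 by apply: f_even; lia.
  have fy : f y = y.+2 by have fy := fP y y_n; case_lia.
  apply: ndep_in; [rewrite /near; lia | lia |].
  move=> i i_n /(near_cases i_n y_n) ni; have fi := fP i i_n; case_lia.
- move=> x y x0 y0; have y_n := ltn_ord y; have x_n := ltn_ord x.
  have fx : f x = x.+2 by apply: f_even; rewrite x0; lia.
  rewrite -y0 in f_last; apply: ndep_out; [rewrite /near; lia | lia |].
  move=> i i_n /(near_cases x_n i_n) ni; have fi := fP i i_n; case_lia.
- move=> x y x0 y0; have z_n : n.-1 < n by lia.
  have fx : f x = x.+2 by apply: f_even; rewrite x0; lia.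
  have fy : f y + p.*2 = y.*2.+2 by apply: f_path; lia.
  by apply: (orient_dep n_ge7 f_near (z := Ordinal z_n)); rewrite /near /=; lia.
- move=> x y x1 y0; have f0 : f 0 = 2 by rewrite f_even //; lia.
  have fx : (f x).+1 = x by apply: f_odd; rewrite x1; lia.
  rewrite -y0 in f_last.
  by apply: (orient_dep n_ge7 f_near (z := o 0 isT)); rewrite /near /=; lia.
Qed.
End Families.

Theorem theorem2 (n : nat) (hn : 7 <= n) :
  fully_orientable (square (cycle_graph n)).
Proof.
move=> k /andP[].
rewrite /dmin; case: arg_minnP => [|D Dac _ Dk].
  exact: rank_orientation_acyclic.
rewrite /dmax; case: arg_maxnP => [|E Eac _ kE].
  exact: rank_orientation_acyclic.
have k_le : k <= n.+1 := leq_trans kE (num_dependent_le hn Eac).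
have k_ge : n.+2 <= k.*2.
  by have := num_dependent_ge hn Dac; lia.
have [->|k_small] := eqVneq k n.+1; first exact: path_orientation.
(* If [2k] is [n + 2] or [n + 3], then [k] is the value of the zigzag; otherwise [p = n + 1 - k]
   satisfies [2p + 2 <= n]. *)
have [n_k|n_k] := leqP n.+4 k.*2; last first.
  have -> : k = (n.+1)./2.+1 by lia.
  exact: zigzag_orientation.
have -> : k = n.+1 - (n.+1 - k) by lia.
by apply: mixed_orientation => //; lia.
Qed.
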